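(* Let $S=\langle a_1,\dots,a_k\rangle\leq I_n$ be an inverse semigroup and let $h\in I_n$. Let $A:=[n]\times[n+1]$ and let $I_A$ be the semigroup of partial bijective maps on $A$. For each $s\in S$ let $\bar s\in I_A$ be given by $(x,y)\bar s=(xs,y)$ (defined exactly when $x\in\mathrm{dom}(s)$). Define $a,b\in I_A$ by $$(x,y)a=(x,y+1)\quad\text{if } y\leq x \text{ and } x\in \mathrm{dom}(h^{-1}),$$ $$(x,y)b=(x,y+1)\quad\text{if } x\in\mathrm{dom}(h)\text{ and } y\leq xh,$$ with $a$ and $b$ undefined at all other points. Let $\bar S=\langle \bar a_1,\dots,\bar a_k,a,b,a^{-1},b^{-1}\rangle\leq I_A$. Then $h\in S$ if and only if both $hh^{-1}\in S$ and $a\sim_i b$ in $\bar S$.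
   Context: $[m]=\{1,\dots,m\}$. $I_n$ is the semigroup of all bijections between subsets of $[n]$ (partial bijections, including the empty map), acting on the right and composed left to right; $I_A$ is defined likewise for the set $A$. $s^{-1}$ is the inverse partial bijection, $\mathrm{dom}(s)$ the domain, and $\langle\cdot\rangle$ the subsemigroup generated. A subsemigroup of $I_n$ (or $I_A$) is an inverse semigroup if it is closed under $s\mapsto s^{-1}$. For an inverse semigroup $T$, $a\sim_i b$ in $T$ iff there exists $s\in T$ with $sas^{-1}=b$ and $s^{-1}bs=a$. *)

(* Defs.v *)
From HB Require Import structures.
From mathcomp Require Import all_boot fingroup.

Set Implicit Arguments.
Unset Strict Implicit.
Unset Printing Implicit Defensive.

Local Open Scope group_scope.

Section PartialBijection.

Variable T : finType.

Definition pinjective (f : T -> option T) : bool :=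
  [forall x, forall y, (f x != None) && (f x == f y) ==> (x == y)].

Lemma pinjectiveP (f : T -> option T) :
  reflect (forall x y z, f x = Some z -> f y = Some z -> x = y) (pinjective f).
Proof.
apply: (iffP forallP) => [inj_f x y z fx fy | inj_f x].
  by have /forallP/(_ y) := inj_f x; rewrite fx fy eqxx /= => /eqP.
apply/forallP => y; apply/implyP; case fx: (f x) => [z|//] /= /eqP fy.
by apply/eqP/(inj_f x y z).
Qed.

(* A bijection between subsets of T: [s x = Some y] when x belongs to dom(s)
   and xs = y, and [s x = None] when x is not in dom(s). *)
Record pbij := PBij {
  pbij_fun :> {ffun T -> option T};
  pbij_inj : pinjective pbij_fun
}.

HB.instance Definition _ := [isSub for pbij_fun].
HB.instance Definition _ := [Finite of pbij by <:].

Implicit Types s t u : pbij.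

Lemma pbijP s x y z : s x = Some z -> s y = Some z -> x = y.
Proof. exact: (pinjectiveP _ (pbij_inj s)). Qed.

Lemma pbij_eqP s t : s =1 t -> s = t.
Proof. by move=> eq_st; apply/val_inj/ffunP. Qed.

Fact mk_pbij_subproof (f : T -> option T) :
  pinjective f -> pinjective [ffun x => f x].
Proof.
by move=> /pinjectiveP fI; apply/pinjectiveP => x y z; rewrite !ffunE; apply: fI.
Qed.

Definition mk_pbij (f : T -> option T) (fI : pinjective f) : pbij :=
  PBij (mk_pbij_subproof fI).

Definition pdom s : {set T} := [set x | s x != None].

Fact pone_subproof : pinjective (@Some T).
Proof. by apply/pinjectiveP => x y z [->] [->]. Qed.

Definition pone : pbij := mk_pbij pone_subproof.

(* Maps act on the right: x(st) = (xs)t. *)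
Fact pmul_subproof s t : pinjective (fun x => obind t (s x)).
Proof.
apply/pinjectiveP => x y z.
case sx: (s x) => [x'|//]; case sy: (s y) => [y'|//] /= tx ty.
by move: sy; rewrite -(pbijP tx ty); apply: pbijP.
Qed.

Definition pmul s t : pbij := mk_pbij (pmul_subproof s t).

Fact pinv_subproof s : pinjective (fun y => [pick x | s x == Some y]).
Proof.
apply/pinjectiveP => y y' z.
case: pickP => [x /eqP sx|//] [<-]; case: pickP => [x' /eqP sx'|//] [eq_x].
by move: sx'; rewrite eq_x sx => -[].
Qed.

Definition pinv s : pbij := mk_pbij (pinv_subproof s).

Fact pmulE s t x : pmul s t x = obind t (s x).
Proof. by rewrite ffunE. Qed.

Fact pinvP s x y : (pinv s y = Some x) <-> (s x = Some y).
Proof.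
rewrite ffunE; case: pickP => [x' /eqP sx'|no_x]; split => //.
- by case=> <-.
- by move=> sx; rewrite (pbijP sx' sx).
- by move=> sx; move: (no_x x); rewrite sx eqxx.
Qed.

Fact pmulA : associative pmul.
Proof.
move=> s t u; apply: pbij_eqP => x; rewrite !pmulE.
by case: (s x) => //= y; rewrite pmulE.
Qed.

Fact pmul1 : left_id pone pmul.
Proof. by move=> s; apply: pbij_eqP => x; rewrite pmulE ffunE. Qed.

Fact pinvK : involutive pinv.
Proof.
move=> s; apply: pbij_eqP => x.
case sx: (s x) => [y|]; first by apply/pinvP/pinvP.
by case ix: (pinv _ x) => [y|//]; move/pinvP/pinvP: ix; rewrite sx.
Qed.

Fact pinvM : {morph pinv : s t / pmul s t >-> pmul t s}.
Proof.
move=> s t; apply: pbij_eqP => z.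
have mulP u v x y :
    pmul u v x = Some y <-> exists2 w, u x = Some w & v w = Some y.
  rewrite pmulE; case ux: (u x) => [w|]; split=> //=.
  - by exists w.
  - by case=> w' [->].
  - by case.
have key x :
    pinv (pmul s t) z = Some x <-> pmul (pinv t) (pinv s) z = Some x.
  split=> [/pinvP/mulP|/mulP] [w].
    by move=> sx tw; apply/mulP; exists w; apply/pinvP.
  by move=> /pinvP tw /pinvP sx; apply/pinvP/mulP; exists w.
case l: (pinv _ z) => [x|]; first by move/key: l ->.
by case r: (pmul _ _ z) => [x|//]; move/key: r; rewrite l.
Qed.

HB.instance Definition _ :=
  isStarMonoid.Build pbij pmulA pmul1 pinvK pinvM.

Lemma mulpE s t x : (s * t) x = obind t (s x).
Proof. exact: pmulE. Qed.

Lemma invpP s x y : (s^-1 y = Some x) <-> (s x = Some y).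
Proof. exact: pinvP. Qed.

End PartialBijection.

Notation "''PB_' n" := (pbij 'I_n)
  (at level 8, n at level 2, format "''PB_' n").

Section Semigroups.

Variable M : finStarMonoidType.

(* Unlike a generated submonoid, this need not contain 1. *)
Definition semigroup_gen (X : {set M}) : {set M} :=
  \bigcap_(G : {set M} | (X \subset G) &&
             [forall x in G, forall y in G, x * y \in G]) G.

Definition inverse_semigroup (S : {set M}) : Prop :=
  {in S &, forall s t, s * t \in S} /\ {in S, forall s, s^-1 \in S}.

Definition conj_i (S : {set M}) (a b : M) : Prop :=
  exists s : M, [/\ s \in S, s * a * s^-1 = b & s^-1 * b * s = a].

End Semigroups.

Section Construction.

Variable n : nat.

(* [n] x [n+1], with both coordinates shifted down by one so as to start from
   0; the comparisons y <= x and y <= xh are unaffected by this shift. *)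
Definition grid : finType := ('I_n * 'I_n.+1)%type.

Fact bar_subproof (s : 'PB_n) :
  pinjective (fun p : grid => omap (fun x => (x, p.2) : grid) (s p.1)).
Proof.
apply/pinjectiveP => -[x y] [x' y'] z /=.
case sx: (s x) => [w|//] [<-]; case sx': (s x') => [w'|//] [eq_w <-].
by rewrite eq_w in sx'; rewrite (pbijP sx sx').
Qed.

Definition bar (s : 'PB_n) : pbij grid := mk_pbij (bar_subproof s).

(* [inord y.+1] is the genuine successor of y, never a default value: in both
   maps y is at most some element of 'I_n, hence y.+1 <= n. *)
Fact up_a_subproof (h : 'PB_n) :
  pinjective (fun p : grid => let: (x, y) := p in
    if (y <= x) && (x \in pdom (h^-1)) then Some ((x, inord y.+1) : grid)
    else None).
Proof.
apply/pinjectiveP => -[x y] [x' y'] z.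
case: ifP => // /andP[le_yx _] [<-]; case: ifP => // /andP[le_yx' _] [-> eq_y].
congr pair; apply/val_inj; move/(congr1 val): eq_y.
by rewrite /= !inordK ?ltnS ?(leq_ltn_trans le_yx) ?(leq_ltn_trans le_yx') // => -[->].
Qed.

Definition up_a (h : 'PB_n) : pbij grid := mk_pbij (up_a_subproof h).

Fact up_b_subproof (h : 'PB_n) :
  pinjective (fun p : grid => let: (x, y) := p in
    if h x is Some xh then
      if y <= xh then Some ((x, inord y.+1) : grid) else None
    else None).
Proof.
apply/pinjectiveP => -[x y] [x' y'] z.
case: (h x) => // w; case: ifP => // le_yw [<-].
case: (h x') => // w'; case: ifP => // le_yw' [-> eq_y].
congr pair; apply/val_inj; move/(congr1 val): eq_y.
by rewrite /= !inordK ?ltnS ?(leq_ltn_trans le_yw) ?(leq_ltn_trans le_yw') // => -[->].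
Qed.

Definition up_b (h : 'PB_n) : pbij grid := mk_pbij (up_b_subproof h).

End Construction.

(* Main.v *)
(* An element s of Sbar conjugating a to b carries the b-chain above each x in
   dom(h), which has xh + 1 points (in the 1-based indexing), injectively onto
   an a-chain, and s^-1 carries that chain back; as the a-chains have pairwise
   distinct lengths, s sends the column of x to the column of xh. Only the
   letters of the form bar t move columns, so deleting the other letters of a
   word for s leaves an element t of S :|: [set 1] which agrees with h on
   dom(h), and then h = h h^-1 t. Conversely bar h conjugates a to b. *)
Require Import Defs.
From mathcomp Require Import all_boot fingroup.

Local Open Scope group_scope.

(* Otherwise [/=] unfolds [bar], [up_a] and [up_b] down to their finfuns. *)
Local Arguments pbij_fun : simpl never.

Section SemigroupGen.

Variable M : finStarMonoidType.
Implicit Types X G : {set M}.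

Lemma sub_semigroup_gen X : X \subset semigroup_gen X.
Proof. by apply/bigcapsP => G /andP[]. Qed.

Lemma semigroup_gen_min X G :
  X \subset G -> {in G &, forall s t, s * t \in G} ->
  semigroup_gen X \subset G.
Proof.
move=> sXG mulG; apply: bigcap_inf; rewrite sXG /=.
by apply/forall_inP => s sG; apply/forall_inP => t tG; apply: mulG.
Qed.

Lemma semigroup_genM X :
  {in semigroup_gen X &, forall s t, s * t \in semigroup_gen X}.
Proof.
move=> s t /bigcapP sX /bigcapP tX; apply/bigcapP => G PG.
have /andP[_ /forall_inP/(_ s (sX G PG))/forall_inP mulG] := PG.
exact/mulG/tX.
Qed.

End SemigroupGen.

Section PartialBijectionTheory.

Variable T : finType.
Implicit Types s t : pbij T.

Lemma onepE x : (1 : pbij T) x = Some x.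
Proof. by rewrite ffunE. Qed.

Lemma mulpP s t x z :
  (s * t) x = Some z <-> exists2 y, s x = Some y & t y = Some z.
Proof.
rewrite mulpE; split; last by case=> y ->.
by case: (s x) => //= y ty; exists y.
Qed.

Lemma pbij_eq_Some s t : (forall x y, s x = Some y <-> t x = Some y) -> s = t.
Proof.
move=> eq_st; apply: pbij_eqP => x; case tx: (t x) => [y|]; first exact/eq_st.
by case sx: (s x) => [y|//]; move/eq_st: sx; rewrite tx.
Qed.

Lemma mem_pdom_inv s y : y \in pdom s^-1 <-> exists x, s x = Some y.
Proof.
rewrite inE; split; last by case=> x /invpP ->.
by case iy: (s^-1 y) => [x|//] _; exists x; apply/invpP.
Qed.

Lemma conj_edge (s a b : pbij T) x y :
    s * a * s^-1 = b -> b x = Some y ->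
  exists x' y', [/\ s x = Some x', a x' = Some y' & s y = Some y'].
Proof.
by move=> <- /mulpP[y' /mulpP[x' sx ax'] /invpP sy]; exists x', y'.
Qed.

(** The product [h * h^-1] is the identity on the domain of [h], so multiplying by it restricts [t]
    to that domain. *)
Lemma restr_eq (h t : pbij T) :
  (forall x y, h x = Some y -> t x = Some y) -> h * h^-1 * t = h.
Proof.
move=> ht; apply: pbij_eq_Some => x y; split.
  case/mulpP=> x' /mulpP[z hx /invpP hx'].
  by rewrite -(pbijP hx hx') => tx; rewrite hx -tx (ht _ _ hx).
move=> hx; apply/mulpP; exists x; last exact: ht.
by apply/mulpP; exists y => //; apply/invpP.
Qed.

End PartialBijectionTheory.

Section Grid.

Variable n : nat.
Implicit Types (s t h : 'PB_n) (p q : grid n) (u : pbij (grid n)).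

Lemma barP s p q : bar s p = Some q <-> s p.1 = Some q.1 /\ q.2 = p.2.
Proof.
rewrite ffunE; split.
  by case: (s p.1) => //= x [<-].
by case: q => x y /= [-> ->].
Qed.

Lemma barM : {morph @bar n : s t / s * t}.
Proof.
move=> s t; apply: pbij_eq_Some => p q; split.
  case/barP=> /mulpP[x sx tx] eq_y; apply/mulpP.
  by exists (x, p.2); apply/barP.
case/mulpP=> r /barP[sx eq_r] /barP[tx eq_q]; apply/barP.
by rewrite eq_q; split=> //; apply/mulpP; exists r.1.
Qed.

Lemma up_aP h p q :
  up_a h p = Some q <->
  [/\ p.1 \in pdom h^-1, p.2 <= p.1 & q = (p.1, inord p.2.+1)].
Proof.
rewrite ffunE; case: p => x y /=; split.
  by case: ifP => // /andP[-> ->] [<-].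
by case=> -> -> ->.
Qed.

Lemma up_bP h p q :
  up_b h p = Some q <->
  (exists w, [/\ h p.1 = Some w, p.2 <= w & q = (p.1, inord p.2.+1)]).
Proof.
rewrite ffunE; case: p => x y /=; split; last by case=> w [-> -> ->].
by case: (h x) => // w; case: ifP => // le_yw [<-]; exists w.
Qed.

(** [bar h] moves column [x] to column [w = xh] without changing heights, so the bound [y <= w] of
    [up_a] in column [w] becomes the bound of [up_b] in column [x]. *)
Lemma bar_conj_up_a h : bar h * up_a h * (bar h)^-1 = up_b h.
Proof.
apply: pbij_eq_Some => -[x y] [x' y']; split.
  case/mulpP=> _ /mulpP[[w z] /barP[/= hx ->] /up_aP[/= _ le_yw ->]].
  move=> /invpP/barP[/= hx' eq_y]; apply/up_bP; exists w.
  by rewrite /= (pbijP hx' hx) -eq_y.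
case/up_bP=> w [/= hx le_yw [-> ->]].
apply/mulpP; exists (w, inord y.+1); last exact/invpP/barP.
apply/mulpP; exists (w, y); first exact/barP.
by apply/up_aP; split=> //; apply/mem_pdom_inv; exists x.
Qed.

Lemma bar_conj_up_b h : (bar h)^-1 * up_b h * bar h = up_a h.
Proof.
apply: pbij_eq_Some => -[x y] [x' y']; split.
  case/mulpP=> r /mulpP[[v z] /invpP/barP[/= hv ->]].
  case/up_bP=> w [/=]; rewrite hv => -[<-] le_zx -> /barP[/=].
  rewrite hv => -[<-] ->; apply/up_aP; split=> //.
  by apply/mem_pdom_inv; exists v.
case/up_aP=> /= /mem_pdom_inv[v hv] le_yx [-> ->].
apply/mulpP; exists (v, inord y.+1); last exact/barP.
apply/mulpP; exists (v, y); first exact/invpP/barP.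
by apply/up_bP; exists x.
Qed.

(** The one feature of [a] and [b] that the chain argument needs; isolating it lets [conj_chain]
    serve for both [u] and [u^-1]. *)
Definition climbs u :=
  forall p q, u p = Some q -> q.1 = p.1 /\ q.2 = p.2.+1 :> nat.

Lemma climbs_up_a h : climbs (up_a h).
Proof.
move=> p _ /up_aP[_ le_p ->]; split=> //=.
by rewrite inordK // ltnS (leq_ltn_trans le_p).
Qed.

Lemma climbs_up_b h : climbs (up_b h).
Proof.
move=> p _ /up_bP[w [_ le_p ->]]; split=> //=.
by rewrite inordK // ltnS (leq_ltn_trans le_p).
Qed.

(** By induction along the chain: [u] sends each edge of [b] to an edge of [a], and consecutive
    edges share a point. That [a] is still defined at every image is kept in order to bound the
    length of the chain. *)
Lemma conj_chain (u a b : pbij (grid n)) x m :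
    u * a * u^-1 = b -> climbs a ->
    (forall j, j <= m -> b (x, inord j) = Some (x, inord j.+1)) ->
  exists2 p, u (x, ord0) = Some p & forall j, j <= m ->
    exists r, [/\ u (x, inord j) = Some r, r.1 = p.1,
                  r.2 = (p.2 + j)%N :> nat & a r != None].
Proof.
move=> uab a_up b_chain.
have ord0E : ord0 = inord 0 :> 'I_n.+1 by apply: val_inj; rewrite /= inordK.
have [p [_ [up _ _]]] := conj_edge _ _ _ _ _ _ uab (b_chain 0 (leq0n m)).
exists p; first by rewrite ord0E.
elim=> [|j IHj] le_jm.
  have [r [r' [ur ar _]]] := conj_edge _ _ _ _ _ _ uab (b_chain _ le_jm).
  exists r; have eq_rp : r = p by move: ur; rewrite up => -[->].
  by rewrite addn0 ar ur eq_rp.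
have [r [ur r1 r2 _]] := IHj (ltnW le_jm).
have [r0 [r' [ur0 ar ur']]] := conj_edge _ _ _ _ _ _ uab (b_chain _ (ltnW le_jm)).
have [r1' [r'' [ur1 ar1 _]]] := conj_edge _ _ _ _ _ _ uab (b_chain _ le_jm).
(* The edges at [j] and [j.+1] are glued: the image of the first ends where the image of the second
   starts. *)
have eq_r : r0 = r by move: ur0; rewrite ur => -[->].
have eq_r' : r1' = r' by move: ur1; rewrite ur' => -[->].
have [r'1 r'2] := a_up _ _ ar.
by exists r'; rewrite ur' r'1 r'2 eq_r r1 r2 addnS -eq_r' ar1.
Qed.

(** With [x'] the column reached, the two conjugation equations give [w <= x'] and [x' <= w] by
    comparing chain lengths. *)
Lemma conj_column h u x w :
    u * up_a h * u^-1 = up_b h -> u^-1 * up_b h * u = up_a h ->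
  h x = Some w -> exists2 p, u (x, ord0) = Some p & p.1 = w.
Proof.
(* This bound ensures that [inord j] has value [j] and is not a default. *)
move=> uab uba hx; have lt_n (z : 'I_n) j : j <= z -> j < n.+1.
  by move=> le_jz; rewrite ltnS ltnW // (leq_ltn_trans le_jz).
have b_chain j : j <= w -> up_b h (x, inord j) = Some (x, inord j.+1).
  by move=> le_jw; apply/up_bP; exists w; rewrite /= inordK ?(lt_n w).
have [[x' y'] ux chain_x] := conj_chain _ _ _ _ _ uab (climbs_up_a h) b_chain.
exists (x', y') => //=.
(* The top of the [b]-chain lands at height [y' + w], where [a] is defined, so [y' + w <= x']. *)
have [[_ z] /= [_ -> def_z]] := chain_x _ (leqnn w).
case az: (up_a h _) => [q|//] _.
have{az} [/= dom_x' le_zx' _] := (up_aP _ _ _).1 az.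
rewrite def_z in le_zx'.
have a_chain j : j <= x' -> up_a h (x', inord j) = Some (x', inord j.+1).
  by move=> le_jx'; apply/up_aP; rewrite /= inordK ?(lt_n x').
have uba' : u^-1 * up_b h * u^-1^-1 = up_a h by rewrite invgK.
have [p _ chain_x'] := conj_chain _ _ _ _ _ uba' (climbs_up_b h) a_chain.
(* The point [(x', y')] lies on the [a]-chain, and [u^-1] takes it back to [(x, ord0)]; hence the
   whole chain returns to column [x]. *)
have le_y'x' : y' <= x' by apply: leq_trans le_zx'; rewrite leq_addr.
have [r [ur r1 _ _]] := chain_x' _ le_y'x'.
have [r' [_ r'1 r'2 br']] := chain_x' _ (leqnn x').
have x_p : p.1 = x.
  move: ur; rewrite inord_val => /invpP ur.
  by rewrite -r1 (pbijP ur ux).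
(* The top of the [a]-chain returns to height [p.2 + x'] in the domain of [b], which forces
   [p.2 + x' <= w]. *)
case br: (up_b h r') br' => [q'|//] _.
have [v [hv le_v _]] := (up_bP _ _ _).1 br.
move: hv; rewrite r'1 x_p hx => -[eq_wv].
apply/val_inj/anti_leq; rewrite (leq_trans (leq_addl _ _) le_zx') andbT.
by rewrite eq_wv (leq_trans _ le_v) // r'2 leq_addl.
Qed.

(** Only an implication: [u] may be defined at fewer points than [t] allows, since [a], [b] and
    their inverses also restrict heights. *)
Definition covers t u :=
  [forall p, forall q, (u p == Some q) ==> (t p.1 == Some q.1)].

Lemma coversP t u :
  reflect (forall p q, u p = Some q -> t p.1 = Some q.1) (covers t u).
Proof.
apply: (iffP forallP) => [tu p q /eqP up | tu p].
  by have /forallP/(_ q)/implyP/(_ up)/eqP := tu p.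
by apply/forallP => q; apply/implyP => /eqP/tu ->.
Qed.

Lemma coversM t t' u u' : covers t u -> covers t' u' -> covers (t * t') (u * u').
Proof.
move=> /coversP tu /coversP tu'; apply/coversP => p q /mulpP[r up ur].
by apply/mulpP; exists r.1; [apply: tu | apply: tu'].
Qed.

Lemma covers1 u : (forall p q, u p = Some q -> q.1 = p.1) -> covers 1 u.
Proof. by move=> u1; apply/coversP => p q /u1 ->; rewrite onepE. Qed.

End Grid.

Theorem proposition4p7 (n k : nat) (gen : 'I_k -> 'PB_n) (h : 'PB_n) :
  let S := semigroup_gen [set gen i | i : 'I_k] in
  let a := up_a h in
  let b := up_b h in
  let Sbar := semigroup_gen
    ([set bar (gen i) | i : 'I_k] :|: [set a; b; a^-1; b^-1]) in
  inverse_semigroup S ->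
  (h \in S <-> h * h^-1 \in S /\ conj_i Sbar a b).
Proof.
move=> S a b Sbar [mulS invS]; split=> [hS | [hhS [u [uS uab uba]]]].
  split; first by rewrite mulS ?invS.
  exists (bar h); split; [| exact: bar_conj_up_a | exact: bar_conj_up_b].
  (* As [bar] is multiplicative, the preimage of [Sbar] is closed under products. *)
  suff /subsetP/(_ h hS) : S \subset [set s | bar s \in Sbar] by rewrite inE.
  apply: semigroup_gen_min => [|s t].
    apply/subsetP => _ /imsetP[i _ ->]; rewrite inE.
    by apply/(subsetP (sub_semigroup_gen _ _))/setUP; left; apply: imset_f.
  by rewrite !inE barM; apply: semigroup_genM.
(* The identity is adjoined because [S] may lack it, while the letters [a], [b] and their inverses,
   which fix columns, are covered by [1]. *)
pose C : {set pbij (grid n)} := [set v | [exists t in 1 |: S, covers n t v]].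
have /subsetP/(_ u uS) : Sbar \subset C.
  apply: semigroup_gen_min => [|v v']; last first.
    rewrite !inE => /exists_inP[t tS tv] /exists_inP[t' tS' tv'].
    apply/exists_inP; exists (t * t'); last exact: coversM.
    move: tS tS'; rewrite !inE => /predU1P[->|tS]; first by rewrite mul1g.
    by case/predU1P=> [->|tS']; rewrite ?mulg1 ?tS ?mulS ?orbT.
  apply/subsetP => v /setUP[/imsetP[i _ ->]|v_ab]; rewrite inE; apply/exists_inP.
    exists (gen i); last by apply/coversP => p q /barP[].
    by rewrite inE (subsetP (sub_semigroup_gen _ _)) ?orbT ?imset_f.
  exists 1; rewrite ?setU11 //; apply: covers1 => p q.
  move: v_ab; rewrite !inE -!orbA => /or4P[] /eqP->.
  - by case/climbs_up_a.
  - by case/climbs_up_b.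
  - by move/invpP; case/climbs_up_a.
  - by move/invpP; case/climbs_up_b.
rewrite inE => /exists_inP[t tS /coversP tu].
have <- : h * h^-1 * t = h.
  apply: restr_eq => x w hx.
  by have [p /tu up <-] := conj_column _ _ _ _ _ uab uba hx.
(* If [t = 1], then [h] equals [h * h^-1], which is in [S] by hypothesis. *)
by move: tS => /setU1P[->|tS]; [rewrite mulg1 | apply: mulS].
Qed.
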